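(* Let $n\ge 1$, $0\le\alpha<n$, $0<\lambda<n$ and $\alpha+\lambda<n$, and set $s=\frac{n-\alpha-\lambda}{\alpha+\lambda}$. Let $C>0$ be fixed, and let $V$ be a positive solution of $$V(x)=C|x|^{-\alpha}\iint_{\mathbb R^n\times\mathbb R^n}\frac{V(y)^s|y|^{-\alpha}V(z)^s|z|^{-\alpha}}{|x-y|^\lambda|x-z|^\lambda|y-z|^\lambda}\,dy\,dz .$$ For $\rho>0$ define $x^\rho:=\frac{\rho^2x}{|x|^2}$ for $x\ne0$, and $$V_\rho(x):=\left(\frac{\rho}{|x|}\right)^{2(\alpha+\lambda)}V(x^\rho).$$ Then, for every $\rho>0$, $V_\rho$, defined on $\mathbb R^n\setminus\{0\}$ by this formula and arbitrarily at the origin, is also a solution of the same equation (with the same $C$) in the a.e. sense.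
   Context: A positive solution is a measurable function $V$ on $\mathbb R^n$, positive and finite a.e., for which the displayed equation holds for a.e. $x\in\mathbb R^n$. *)

(* Defs.v *)
From HB Require Import structures.
From mathcomp Require Import all_boot all_order all_algebra.
From mathcomp Require Import all_classical all_reals all_analysis.
From mathcomp Require Import measurable_realfun.

Set Implicit Arguments.
Unset Strict Implicit.
Unset Printing Implicit Defensive.

Import Order.TTheory GRing.Theory Num.Theory.
Import numFieldNormedType.Exports.

Local Open Scope classical_set_scope.
Local Open Scope ring_scope.

(* The library gives tuples the product of the Borel sigma-algebras of the
   coordinates, so [measurable] on [euclid R n] means Borel in R^n. *)
Notation euclid R n := (n.-tuple (measurableTypeR R)).

Definition tcons (R : realType) (n : nat)
  (p : measurableTypeR R * euclid R n) : euclid R n.+1 := [tuple of p.1 :: p.2].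

Definition tuncons (R : realType) (n : nat) (x : euclid R n.+1) :
  measurableTypeR R * euclid R n := (thead x, [tuple of behead x]).

Lemma tconsK (R : realType) (n : nat) : cancel (@tcons R n) (@tuncons R n).
Proof.
by case=> a x; rewrite /tuncons /=; congr pair; apply/val_inj.
Qed.

Lemma tunconsK (R : realType) (n : nat) : cancel (@tuncons R n) (@tcons R n).
Proof. by move=> x; rewrite [RHS]tuple_eta; apply/val_inj. Qed.

Lemma measurable_tcons (R : realType) (n : nat) :
  measurable_fun setT (@tcons R n).
Proof. exact: measurable_cons. Qed.

Lemma measurable_tuncons (R : realType) (n : nat) :
  measurable_fun setT (@tuncons R n).
Proof.
apply: measurable_fun_pair; last exact: measurable_behead.
exact: measurable_tnth.
Qed.

Definition lebesgue_succ (R : realType) (n : nat)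
    (mu : {sigma_finite_measure set (euclid R n) -> \bar R}) :
    set (euclid R n.+1) -> \bar R :=
  pushforward ((@lebesgue_measure R) \x mu)%E (@tcons R n).

Section lebesgue_succ_measure.
Context (R : realType) (n : nat).
Variable mu : {sigma_finite_measure set (euclid R n) -> \bar R}.

Let lebesgue_succ0 : lebesgue_succ mu set0 = 0%E.
Proof. by rewrite /lebesgue_succ /pushforward preimage_set0 measure0. Qed.

Let lebesgue_succ_ge0 A : (0 <= lebesgue_succ mu A)%E.
Proof. by rewrite /lebesgue_succ /pushforward; exact: measure_ge0. Qed.

Let lebesgue_succ_sigma_additive : semi_sigma_additive (lebesgue_succ mu).
Proof.
exact: (@measure_semi_sigma_additive _ _ _
  (measure_function_pushforward__canonical__measure_function_Measure
    ((@lebesgue_measure R) \x mu)%E (@measurable_tcons R n))).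
Qed.

HB.instance Definition _ := isMeasure.Build _ _ _ (lebesgue_succ mu)
  lebesgue_succ0 lebesgue_succ_ge0 lebesgue_succ_sigma_additive.

Let lebesgue_succ_sigma_finite : sigma_finite setT (lebesgue_succ mu).
Proof.
have /sigma_finiteP[F [FT ndF Foo]] := sigma_finiteT (@lebesgue_measure R).
have /sigma_finiteP[G [GT ndG Goo]] := sigma_finiteT mu.
exists (fun k => @tuncons R n @^-1` (F k `*` G k)).
  rewrite -preimage_bigcup; apply/esym/seteqP; split=> // x _.
  have [i _ Fi] : (\bigcup_k F k) (tuncons x).1 by rewrite -FT.
  have [j _ Gj] : (\bigcup_k G k) (tuncons x).2 by rewrite -GT.
  exists (maxn i j) => //; split.
    by move: Fi; exact/subsetPset/ndF/leq_maxl.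
  by move: Gj; exact/subsetPset/ndG/leq_maxr.
move=> k; have [mF Fk] := Foo k; have [mG Gk] := Goo k; split.
  rewrite -[X in measurable X]setTI; apply: measurable_tuncons => //.
  exact: measurableX.
rewrite /lebesgue_succ /pushforward -comp_preimage.
rewrite (_ : _ \o _ = id); last by apply/funext => p /=; rewrite tconsK.
by rewrite preimage_id product_measure1E// lte_mul_pinfty// ge0_fin_numE.
Qed.

HB.instance Definition _ := @Measure_isSigmaFinite.Build _ _ _
  (lebesgue_succ mu) lebesgue_succ_sigma_finite.

End lebesgue_succ_measure.

Fixpoint lebesgue_euclid (R : realType) (n : nat) :
    {sigma_finite_measure set (euclid R n) -> \bar R} :=
  match n with
  | 0 => dirac ([tuple] : euclid R 0)
  | m.+1 => lebesgue_succ (lebesgue_euclid R m)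
  end.

Lemma lebesgue_euclid_box (R : realType) (n : nat)
    (A : 'I_n -> set (measurableTypeR R)) :
  (forall i, measurable (A i)) ->
  lebesgue_euclid R n [set x | forall i, A i (tnth x i)] =
  (\prod_(i < n) lebesgue_measure (A i))%E.
Proof.
elim: n A => [|n IH] A mA.
  rewrite big_ord0 /= diracE mem_set//= => -[].
  by [].
rewrite big_ord_recl /= /lebesgue_succ /pushforward.
rewrite -IH; last by move=> i; exact: mA.
rewrite -product_measure1E//.
  congr (_ _); apply/seteqP; split=> -[a x] /= H.
    split=> [|i]; first by have := H ord0.
    by have := H (lift ord0 i); rewrite tnthS.
  move=> i; case: (unliftP ord0 i) => [j ->|->]; last exact: H.1.
  by rewrite tnthS; exact: H.2.
rewrite (_ : [set x | _] =
    \bigcap_(i : 'I_n) ((fun x => tnth x i) @^-1` A (lift ord0 i))).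
  apply: fin_bigcap_measurable => // i _.
  by rewrite -[X in measurable X]setTI; exact: measurable_tnth.
by apply/seteqP; split=> x /= H i; [move=> _|]; apply: H.
Qed.

(* Lebesgue (rather than Borel) measurability: the source carries the
   completion of the Borel sigma-algebra under Lebesgue measure. *)
Definition lebesgue_measurable_fun (R : realType) (n : nat)
    (V : euclid R n -> \bar R) : Prop :=
  measurable_fun
    [set: g_sigma_algebraType (completed_algebra_gen (lebesgue_euclid R n))] V.

Definition eucl_norm (R : realType) (n : nat) (x : euclid R n) : R :=
  Num.sqrt (\sum_(i < n) (tnth x i : R) ^+ 2).

Definition eucl_dist (R : realType) (n : nat) (x y : euclid R n) : R :=
  eucl_norm ([tuple (tnth x i : R) - tnth y i | i < n] : euclid R n).

(* The point x^rho = rho^2 x / |x|^2; its value at the origin is immaterial. *)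
Definition inversion (R : realType) (n : nat) (rho : R) (x : euclid R n) :
  euclid R n := [tuple rho ^+ 2 * tnth x i / eucl_norm x ^+ 2 | i < n].

Section equation.
Local Open Scope ereal_scope.

(* V is extended-real valued because solutions are only finite a.e. The values
   that total division and powers give where |y|, |z|, |x - y|, |x - z| or
   |y - z| vanishes only matter on a null set. The product measure is on Borel
   sets; as the integral of a nonnegative function is a supremum over simple
   minorants, it still has the usual value when V is only Lebesgue measurable,
   hence a.e. equal to a Borel function. *)
Definition equation_rhs (R : realType) (n : nat) (alpha lambda C : R)
    (V : euclid R n -> \bar R) (x : euclid R n) : \bar R :=
  let s := ((n%:R - alpha - lambda) / (alpha + lambda))%R in
  (C * eucl_norm x `^ (- alpha))%:E *
  \int[lebesgue_euclid R n \x lebesgue_euclid R n]_yz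
    (V yz.1 `^ s * (eucl_norm yz.1 `^ (- alpha))%:E *
     (V yz.2 `^ s * (eucl_norm yz.2 `^ (- alpha))%:E) *
     ((eucl_dist x yz.1 `^ lambda * eucl_dist x yz.2 `^ lambda *
       eucl_dist yz.1 yz.2 `^ lambda)^-1)%:E).

Definition positive_solution (R : realType) (n : nat) (alpha lambda C : R)
    (V : euclid R n -> \bar R) : Prop :=
  [/\ lebesgue_measurable_fun V,
      {ae lebesgue_euclid R n, forall x, 0 < V x < +oo} &
      {ae lebesgue_euclid R n, forall x, V x = equation_rhs alpha lambda C V x}].

End equation.

(* Main.v *)
Require Import Defs.
From HB Require Import structures.
From mathcomp Require Import all_boot all_order all_algebra.
From mathcomp Require Import all_classical all_reals all_analysis.
From mathcomp Require Import measurable_realfun.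
From mathcomp Require Import ring lra.

Set Implicit Arguments.
Unset Strict Implicit.
Unset Printing Implicit Defensive.

Import Order.TTheory GRing.Theory Num.Theory.
Import numFieldNormedType.Exports.

Local Open Scope classical_set_scope.
Local Open Scope ring_scope.

(** Substitute the inversion y = y'^rho, z = z'^rho in the double integral taken
    at the point x^rho.  Three facts make the equation reproduce itself:
    - the distances are conformally covariant,
      |x^rho - y^rho| = (rho/|x|) (rho/|y|) |x - y|  ([eucl_dist_inversion]);
    - the Jacobian of the inversion is (rho/|y|)^(2n)
      ([ge0_integral_inversion]);
    - the exponent s is the one for which all the powers of rho/|y| cancel:
      2n - 2 alpha - 2 lambda = 2 (alpha + lambda) s
      ([powR_conformal_weight]).
    What remains is a power of rho/|x| alone, and it is the factor in the
    definition of V_rho ([equation_rhs_kelvin]).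

    The change of variables avoids differential calculus.  Lebesgue measure
    scales as t^n under x |-> t x, and this alone yields a form of polar
    coordinates ([ge0_integral_polar]): the integral of G is an integral, over
    the shell 1/e < |x| <= 1, of the ray integrals of e^(nu) G(e^u x) du.  On
    the ray through x the inversion acts as u |-> c - u, so that only the
    invariance of one-dimensional Lebesgue measure under translation and
    reflection is needed.

    These computations are done for a Borel function v, everywhere finite and
    positive.  A Lebesgue measurable solution V agrees with such a v off a
    Borel null set ([positive_representative]), and the right-hand side of the
    equation does not see null sets, even for an integrand that is not Borel
    ([equation_rhs_off_null]).  Finally the inversion preserves null sets
    ([null_preimage_inversion]), so that what holds for v almost everywhere
    holds for V_rho almost everywhere. *)

(** * Affine maps of the line and dilations of Euclidean space *)

Lemma measurable_integral_pair (d1 d2 : measure_display)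
    (T1 : measurableType d1) (T2 : measurableType d2) (R : realType)
    (m : {sigma_finite_measure set T2 -> \bar R}) (f : T1 * T2 -> \bar R) :
  measurable_fun setT f -> (forall z, 0 <= f z)%E ->
  measurable_fun setT (fun x => \int[m]_y f (x, y))%E.
Proof. by move=> mf f0; exact: measurable_fun_fubini_tonelli_F. Qed.

(** Both sides are integrals of [f], against Lebesgue measure and against [c]
    times its image under the affine map; the two measures agree on
    half-open intervals, hence everywhere. *)
Lemma ge0_integral_affine (R : realType) (c d : R)
    (f : measurableTypeR R -> \bar R) :
  0 < c -> measurable_fun setT f -> (forall x, 0 <= f x)%E ->
  (c%:E * \int[lebesgue_measure]_x f (c * x + d)%R =
   \int[lebesgue_measure]_x f x)%E.
Proof.
move=> c0 mf f0.
pose phi (x : measurableTypeR R) : measurableTypeR R := c * x + d.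
have mphi : measurable_fun setT phi.
  by apply: measurable_funD => //; exact: measurable_funM.
pose k : {nonneg R} := NngNum (ltW c0).
pose push := measure_function_pushforward__canonical__measure_function_Measure
  (@lebesgue_measure R) mphi.
rewrite -[X in (_ * X)%E]/(\int[lebesgue_measure]_(x in phi @^-1` setT) (f \o phi) x)%E.
rewrite -(ge0_integral_pushforward mphi)//.
rewrite -[LHS](@ge0_integral_mscale _ _ _ push setT measurableT k)//.
apply: eq_measure_integral => A mA _; apply/esym.
apply: (@lebesgue_measure_unique _ (mscale k push)) => // _ [[a b]] _ <-.
rewrite -[RHS]/(c%:E * lebesgue_measure (phi @^-1` `]a, b]))%E.
rewrite (_ : phi @^-1` _ = `](a - d) / c, (b - d) / c]%classic); last first.
  apply/seteqP; split=> x /=; rewrite !in_itv/= /phi.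
    by rewrite ltr_pdivrMr// ler_pdivlMr//; lra.
  by rewrite ltr_pdivrMr// ler_pdivlMr//; lra.
rewrite !lebesgue_measure_itv/= !lte_fin ltr_pM2r ?invr_gt0// ltrD2r.
case: ifP => ab; last by rewrite mule0.
by rewrite -!EFinD -EFinM; congr EFin; field; rewrite gt_eqF.
Qed.

Lemma ge0_integral_opp (R : realType) (f : measurableTypeR R -> \bar R) :
  measurable_fun setT f -> (forall x, 0 <= f x)%E ->
  (\int[lebesgue_measure]_x f (- x)%R = \int[lebesgue_measure]_x f x)%E.
Proof.
move=> mf f0.
have mopp : measurable_fun setT (-%R : measurableTypeR R -> measurableTypeR R).
  by [].
rewrite -[LHS](ge0_integral_pushforward mopp lebesgue_measure measurableT)//.
by apply: eq_measure_integral => A mA _; exact: lebesgue_measureN.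
Qed.

Definition dilation (R : realType) (n : nat) (t : R) (x : euclid R n) :
  euclid R n := [tuple t * tnth x i | i < n].

Lemma measurable_dilation (R : realType) (n : nat) (d : measure_display)
    (T : measurableType d) (t : T -> R) (f : T -> euclid R n) :
  measurable_fun setT t -> measurable_fun setT f ->
  measurable_fun setT (fun x => dilation (t x) (f x)).
Proof.
move=> mt mf; apply/measurable_fun_tnthP => i.
rewrite (_ : _ \o _ = fun x => t x * tnth (f x) i); last first.
  by apply/funext => x /=; rewrite tnth_mktuple.
apply: measurable_funM => //.
exact: (measurableT_comp (measurable_tnth i)).
Qed.

Lemma ge0_integral_euclidS (R : realType) (n : nat)
    (f : euclid R n.+1 -> \bar R) :
  measurable_fun setT f -> (forall x, 0 <= f x)%E ->
  (\int[lebesgue_euclid R n.+1]_x f x =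
   \int[lebesgue_measure]_a \int[lebesgue_euclid R n]_x f (tcons (a, x)))%E.
Proof.
move=> mf f0.
have mtc := @measurable_tcons R n.
rewrite [LHS](ge0_integral_pushforward mtc
  (lebesgue_measure \x lebesgue_euclid R n)%E measurableT)//.
rewrite fubini_tonelli1//; first exact: measurableT_comp.
by move=> x; exact: f0.
Qed.

(** Induction on the dimension: the coordinate split off by Tonelli contributes
    one factor [t], through the one-dimensional case. *)
Lemma ge0_integral_dilation (R : realType) (n : nat) (t : R)
    (f : euclid R n -> \bar R) :
  0 < t -> measurable_fun setT f -> (forall x, 0 <= f x)%E ->
  ((t ^+ n)%:E * \int[lebesgue_euclid R n]_x f (dilation t x) =
   \int[lebesgue_euclid R n]_x f x)%E.
Proof.
move=> t0; elim: n f => [|n IH] f mf f0.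
  rewrite expr0 mul1e; apply: eq_integral => x _; congr f.
  by apply: eq_from_tnth => -[].
have mdil m : measurable_fun setT (@dilation R m t).
  by apply: (measurable_dilation (t := cst t) (f := id)).
have mfd : measurable_fun setT (fun x => f (dilation t x)).
  exact: (measurableT_comp mf (mdil _)).
have mtc := @measurable_tcons R n.
have mftc : measurable_fun setT (f \o @tcons R n) by exact: measurableT_comp.
have mG : measurable_fun setT
    (fun a => \int[lebesgue_euclid R n]_x f (tcons (a, x)))%E.
  by apply: (@measurable_integral_pair _ _ _ _ _ _ (f \o @tcons R n)) => // x; exact: f0.
have G0 a : (0 <= \int[lebesgue_euclid R n]_x f (tcons (a, x)))%E.
  exact: integral_ge0.
rewrite !ge0_integral_euclidS// -(ge0_integral_affine 0 t0 mG G0).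
rewrite exprS EFinM -muleA; congr (_ * _)%E.
rewrite -ge0_integralZl_EFin//; last 3 first.
- by move=> a _; exact: integral_ge0.
- apply: (@measurable_integral_pair _ _ _ _ _ _
    ((fun x => f (dilation t x)) \o @tcons R n)).
    exact: (measurableT_comp mfd mtc).
  by move=> x; exact: f0.
- by rewrite exprn_ge0// ltW.
apply: eq_integral => a _.
rewrite -[RHS]IH//; last exact: (measurableT_comp mftc (measurable_pair1 _)).
congr (_ * _)%E; apply: eq_integral => x _; congr f.
apply: eq_from_tnth => i; rewrite /dilation tnth_mktuple.
case: (unliftP ord0 i) => [j ->|->]; first by rewrite !tnthS tnth_mktuple.
by rewrite !tnth0/= addr0.
Qed.

(** * The Euclidean norm *)

Lemma measurable_eucl_norm (R : realType) (n : nat) :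
  measurable_fun setT (@eucl_norm R n).
Proof.
have -> : @eucl_norm R n =
    fun x => (\sum_(i < n) (tnth x i : R) ^+ 2) `^ 2^-1.
  by apply/funext => x; rewrite powR12_sqrt// sumr_ge0// => i _; exact: sqr_ge0.
apply: (measurableT_comp (@measurable_powR R 2^-1)).
apply: measurable_sum => i.
by apply: measurable_funX; exact: measurable_tnth.
Qed.

Lemma eucl_norm_ge0 (R : realType) (n : nat) (x : euclid R n) :
  0 <= eucl_norm x.
Proof. exact: sqrtr_ge0. Qed.

Lemma sqr_eucl_norm (R : realType) (n : nat) (x : euclid R n) :
  eucl_norm x ^+ 2 = \sum_(i < n) (tnth x i : R) ^+ 2.
Proof. by rewrite sqr_sqrtr// sumr_ge0// => i _; exact: sqr_ge0. Qed.

Lemma eucl_norm_eq0 (R : realType) (n : nat) (x : euclid R n) :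
  eucl_norm x = 0 -> x = [tuple 0 | i < n].
Proof.
move=> x0; apply: eq_from_tnth => i; rewrite tnth_mktuple.
have /eqP : \sum_(i < n) (tnth x i : R) ^+ 2 = 0.
  by rewrite -sqr_eucl_norm x0 expr0n.
rewrite psumr_eq0; last by move=> j _; exact: sqr_ge0.
by move=> /allP/(_ i (mem_index_enum i)); rewrite sqrf_eq0 => /eqP.
Qed.

Lemma eucl_norm0 (R : realType) (n : nat) :
  eucl_norm ([tuple 0 | i < n] : euclid R n) = 0.
Proof.
by rewrite /eucl_norm big1 ?sqrtr0// => i _; rewrite tnth_mktuple expr0n.
Qed.

Lemma eucl_norm_dilation (R : realType) (n : nat) (t : R) (x : euclid R n) :
  0 <= t -> eucl_norm (dilation t x) = t * eucl_norm x.
Proof.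
move=> t0; rewrite /eucl_norm -{2}(ger0_norm t0) -sqrtr_sqr -sqrtrM ?sqr_ge0//.
congr Num.sqrt; rewrite mulr_sumr; apply: eq_bigr => i _.
by rewrite tnth_mktuple exprMn.
Qed.

Lemma dilationM (R : realType) (n : nat) (s t : R) (x : euclid R n) :
  dilation s (dilation t x) = dilation (s * t) x.
Proof. by apply: eq_from_tnth => i; rewrite !tnth_mktuple mulrA. Qed.

Lemma inversionE (R : realType) (n : nat) (rho : R) (x : euclid R n) :
  inversion rho x = dilation (rho ^+ 2 / eucl_norm x ^+ 2) x.
Proof. by apply: eq_from_tnth => i; rewrite !tnth_mktuple mulrAC. Qed.

Lemma lebesgue_euclid_origin (R : realType) (n : nat) : (0 < n)%N ->
  lebesgue_euclid R n [set x | eucl_norm x = 0] = 0%E.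
Proof.
case: n => // n _.
rewrite (_ : [set x | _] = [set x | forall i, [set (0 : R)] (tnth x i)]).
  rewrite (@lebesgue_euclid_box R n.+1 (fun=> [set 0]))// big_ord_recl.
  by rewrite lebesgue_measure_set1 mul0e.
apply/seteqP; split=> x /=.
  by move=> /eucl_norm_eq0 -> i; rewrite tnth_mktuple.
move=> x0; rewrite (_ : x = [tuple 0 | i < n.+1]) ?eucl_norm0//.
by apply: eq_from_tnth => i; rewrite tnth_mktuple x0.
Qed.

Lemma measurable_origin (R : realType) (n : nat) :
  measurable [set x : euclid R n | eucl_norm x = 0].
Proof.
have := measurable_eucl_norm (R := R) (n := n) measurableT (measurable_set1 0).
by rewrite setTI.
Qed.

(** * Polar coordinates from scaling *)

(** The cut-off of the polar formula: any nonnegative Borel function of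
    total mass 1 on the line would serve. *)
Definition indic01 (R : realType) (t : R) : R :=
  \1_(`[0, 1[%classic : set R) t.

Lemma measurable_indic01 (R : realType) : measurable_fun setT (@indic01 R).
Proof. exact: measurable_indic. Qed.

Lemma indic01_ge0 (R : realType) (t : R) : 0 <= indic01 t.
Proof. by rewrite /indic01 indicE. Qed.

Lemma integral_indic_shift (R : realType) (c : R) :
  (\int[lebesgue_measure]_u (indic01 (u - c))%:E =
   1 :> \bar R)%E.
Proof.
have m01 : measurable_fun setT
    (fun u : measurableTypeR R => (indic01 u)%:E).
  by apply/measurable_EFinP; exact: measurable_indic01.
have := ge0_integral_affine (R := R) (- c) ltr01 m01.
under eq_integral do rewrite mul1r.
rewrite mul1e => ->; last by move=> x; rewrite lee_fin indic01_ge0.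
rewrite integral_indic// setIT.
transitivity (lebesgue_measure (`[0, 1[%classic : set R)) => [//|].
rewrite lebesgue_measure_itv/= lte01.
by rewrite oppr0 adde0.
Qed.

(** Write 1 as the integral over u of the cut-off at u - ln |x|, exchange the
    integrals, and replace x by e^u x for fixed u: the cut-off becomes
    independent of u and the dilation contributes e^(nu).  As [ln 0 = 0], the
    identity ln |e^u x| = u + ln |x| fails at the origin, hence the condition
    that [G] vanishes there. *)
Lemma ge0_integral_polar (R : realType) (n : nat) (G : euclid R n -> \bar R) :
  measurable_fun setT G -> (forall x, 0 <= G x)%E ->
  (forall x, eucl_norm x = 0 -> G x = 0%E) ->
  (\int[lebesgue_euclid R n]_x G x =
   \int[lebesgue_euclid R n]_x ((indic01 (- ln (eucl_norm x)))%:E *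
     \int[lebesgue_measure]_u ((expR u ^+ n)%:E * G (dilation (expR u) x))))%E.
Proof.
move=> mG G0 Gorigin.
have mln : measurable_fun setT (fun x : euclid R n => ln (eucl_norm x)).
  by apply: measurableT_comp => //; exact: measurable_eucl_norm.
have mind : measurable_fun setT (@indic01 R).
  exact: measurable_indic01.
pose w (z : euclid R n * measurableTypeR R) : \bar R :=
  ((indic01 (z.2 - ln (eucl_norm z.1)))%:E)%E.
have mw : measurable_fun setT w.
  apply/measurable_EFinP; apply: (measurableT_comp mind).
  by apply: measurable_funB => //; exact: (measurableT_comp mln).
have w0 z : (0 <= w z)%E by rewrite lee_fin indic01_ge0.
have mexp : measurable_fun setT (fun u : R => (expR u ^+ n)%:E).
  by apply/measurable_EFinP; apply: measurable_funX; exact: measurable_expR.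
have mdil : measurable_fun setT (fun z : euclid R n * measurableTypeR R =>
    G (dilation (expR z.2) z.1)).
  apply: (measurableT_comp mG); apply: measurable_dilation => //.
  by apply: (measurableT_comp (@measurable_expR R)).
have mwG : measurable_fun setT (fun z => w z * G z.1)%E.
  by apply: emeasurable_funM => //; exact: (measurableT_comp mG).
have mH : measurable_fun setT (fun z : euclid R n * measurableTypeR R =>
    (indic01 (- ln (eucl_norm z.1)))%:E *
     ((expR z.2 ^+ n)%:E * G (dilation (expR z.2) z.1)))%E.
  apply: emeasurable_funM; last first.
    by apply: emeasurable_funM => //; exact: (measurableT_comp mexp).
  apply/measurable_EFinP; apply: (measurableT_comp mind).
  by apply/measurable_funN; exact: (measurableT_comp mln).
have H0 z : (0 <= (indic01 (- ln (eucl_norm z.1)))%:E *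
     ((expR z.2 ^+ n)%:E * G (dilation (expR z.2) z.1)))%E.
  by rewrite !mule_ge0// lee_fin ?indic01_ge0// exprn_ge0// expR_ge0.
transitivity (\int[lebesgue_euclid R n]_x \int[lebesgue_measure]_u
    (w (x, u) * G x))%E.
  apply: eq_integral => x _; rewrite ge0_integralZr//.
  - by rewrite /w/= integral_indic_shift mul1e.
  - exact: (measurableT_comp mw (measurable_pair1 _)).
rewrite (fubini_tonelli (fun z => w z * G z.1)%E)//=; last first.
  by move=> z; rewrite mule_ge0.
transitivity (\int[lebesgue_measure]_u \int[lebesgue_euclid R n]_x
    ((indic01 (- ln (eucl_norm x)))%:E *
     ((expR u ^+ n)%:E * G (dilation (expR u) x))))%E.
  apply: eq_integral => u _.
  have mwGu := measurableT_comp mwG (measurable_pair2 u).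
  rewrite -(ge0_integral_dilation (expR_gt0 u) mwGu); last first.
    by move=> x; rewrite mule_ge0.
  rewrite -ge0_integralZl_EFin; last 4 first.
  - exact: measurableT.
  - by move=> x _; rewrite mule_ge0.
  - apply: (measurableT_comp (measurableT_comp mwG (measurable_pair2 u))).
    by apply: (measurable_dilation (t := cst (expR u)) (f := id)).
  - by rewrite exprn_ge0// expR_ge0.
  apply: eq_integral => x _; rewrite muleCA; rewrite /w/=.
  have [x0|x0] := eqVneq (eucl_norm x) 0.
    by rewrite Gorigin ?mule0// eucl_norm_dilation ?expR_ge0// x0 mulr0.
  have xgt0 : 0 < eucl_norm x by rewrite lt_def x0 eucl_norm_ge0.
  rewrite eucl_norm_dilation ?expR_ge0// lnM ?posrE ?expR_gt0// expRK.
  by congr ((indic01 _)%:E * _)%E; ring.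
rewrite -(fubini_tonelli (fun z : euclid R n * measurableTypeR R =>
   (indic01 (- ln (eucl_norm z.1)))%:E *
     ((expR z.2 ^+ n)%:E * G (dilation (expR z.2) z.1)))%E)//=.
apply: eq_integral => x _; rewrite ge0_integralZl_EFin//.
- by move=> u _; rewrite mule_ge0// lee_fin exprn_ge0// expR_ge0.
- apply: emeasurable_funM => //.
  exact: (measurableT_comp mdil (measurable_pair1 x)).
Qed.

(** * Change of variables under the inversion *)

Lemma measurable_eucl_normV (R : realType) (n : nat) :
  measurable_fun setT (fun x : euclid R n => (eucl_norm x)^-1).
Proof.
have -> : (fun x : euclid R n => (eucl_norm x)^-1) =
    (@powR R ^~ (- 1)) \o @eucl_norm R n.
  by apply/funext => x /=; rewrite powR_inv1// eucl_norm_ge0.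
exact: (measurableT_comp (@measurable_powR R (- 1))
  (@measurable_eucl_norm R n)).
Qed.

Lemma measurable_inversion (R : realType) (n : nat) (rho : R) :
  measurable_fun setT (@inversion R n rho).
Proof.
have -> : @inversion R n rho =
    fun x => dilation (rho ^+ 2 * (eucl_norm x)^-1 ^+ 2) x.
  by apply/funext => x; rewrite inversionE exprVn.
apply: measurable_dilation => //.
apply: measurable_funM => //; apply: measurable_funX.
exact: measurable_eucl_normV.
Qed.

Lemma eucl_norm_gt0 (R : realType) (n : nat) (x : euclid R n) :
  (0 < eucl_norm x) = (eucl_norm x != 0).
Proof. by rewrite lt_def eucl_norm_ge0 andbT. Qed.

Lemma eucl_norm_inversion (R : realType) (n : nat) (rho : R)
    (x : euclid R n) :
  eucl_norm (inversion rho x) = rho ^+ 2 / eucl_norm x.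
Proof.
rewrite inversionE eucl_norm_dilation; last first.
  by rewrite divr_ge0// sqr_ge0.
have [->|x0] := eqVneq (eucl_norm x) 0; first by rewrite invr0 !mulr0.
by field.
Qed.

(** With c = ln (rho^2 / |x|^2), the inverse of e^u x is e^(c - u) x, and
    e^(nu) times the Jacobian at e^u x is e^(n(c - u)): the left-hand side is
    the right-hand side after the substitution u |-> c - u. *)
Lemma integral_inversion_ray (R : realType) (n : nat) (rho : R)
    (f : euclid R n -> \bar R) (x : euclid R n) :
  0 < rho -> measurable_fun setT f -> (forall x, 0 <= f x)%E ->
  eucl_norm x != 0 ->
  (\int[lebesgue_measure]_u ((expR u ^+ n)%:E *
     (f (inversion rho (dilation (expR u) x)) *
      ((rho / eucl_norm (dilation (expR u) x)) ^+ (2 * n))%:E)) =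
   \int[lebesgue_measure]_u ((expR u ^+ n)%:E * f (dilation (expR u) x)))%E.
Proof.
move=> rho0 mf f0 x0; pose r := eucl_norm x.
have r0 : 0 < r by rewrite eucl_norm_gt0.
pose c := ln (rho ^+ 2 / r ^+ 2).
pose h (w : measurableTypeR R) := ((expR w ^+ n)%:E * f (dilation (expR w) x))%E.
have h0 w : (0 <= h w)%E by rewrite mule_ge0// lee_fin exprn_ge0// expR_ge0.
have mh : measurable_fun setT h.
  apply: emeasurable_funM.
    apply/measurable_EFinP; apply: measurable_funX; exact: measurable_expR.
  apply: (measurableT_comp mf).
  by apply: (measurable_dilation (f := cst x)) => //; exact: measurable_expR.
have mhc : measurable_fun setT (fun w : measurableTypeR R => h (1 * w + c)).
  have mshift : measurable_fun setT (fun w : R => 1 * w + c).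
    by apply: measurable_funD => //; exact: measurable_funM.
  exact: (measurableT_comp mh mshift).
rewrite -[RHS](ge0_integral_affine c ltr01 mh h0) mul1e.
rewrite -(ge0_integral_opp mhc) //.
apply: eq_integral => u _; rewrite /h.
have u0 := expR_gt0 u.
have -> : expR (1 * - u + c) = rho ^+ 2 / r ^+ 2 / expR u.
  by rewrite mul1r expRD expRN lnK ?posrE ?divr_gt0 ?exprn_gt0// mulrC.
have -> : inversion rho (dilation (expR u) x) =
    dilation (rho ^+ 2 / r ^+ 2 / expR u) x.
  rewrite inversionE dilationM eucl_norm_dilation ?expR_ge0// -/r.
  by congr dilation; field; rewrite !gt_eqF.
rewrite muleCA muleC -EFinM; congr (_%:E * _)%E.
rewrite exprM -exprMn eucl_norm_dilation ?expR_ge0// -/r; congr (_ ^+ _).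
by field; rewrite !gt_eqF.
Qed.

(** The inversion permutes the rays, so the polar formula reduces the claim to
    [integral_inversion_ray].  The formula wants functions vanishing at the
    origin: the left integrand does, since its Jacobian is 0 there, and the
    right one is modified on that null set. *)
Lemma ge0_integral_inversion (R : realType) (n : nat) (rho : R)
    (f : euclid R n -> \bar R) :
  (0 < n)%N -> 0 < rho -> measurable_fun setT f -> (forall x, 0 <= f x)%E ->
  (\int[lebesgue_euclid R n]_x
     (f (inversion rho x) * ((rho / eucl_norm x) ^+ (2 * n))%:E) =
   \int[lebesgue_euclid R n]_x f x)%E.
Proof.
move=> n0 rho0 mf f0.
have mfinv : measurable_fun setT (fun x => f (inversion rho x)).
  exact: (measurableT_comp mf (@measurable_inversion R n rho)).
have mJ : measurable_fun setT
    (fun x : euclid R n => ((rho / eucl_norm x) ^+ (2 * n))%:E).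
  apply/measurable_EFinP; apply: measurable_funX; apply: measurable_funM => //.
  exact: measurable_eucl_normV.
pose f' := f \_ (~` [set x | eucl_norm x = 0]).
have mf' : measurable_fun setT f'.
  apply/(measurable_restrictT f (measurableC (@measurable_origin R n))).
  exact: (measurable_funTS mf).
have f'0 x : (0 <= f' x)%E by exact: erestrict_ge0.
have f'E x : eucl_norm x != 0 -> f' x = f x.
  by move=> /eqP x0; rewrite /f' patchE mem_set.
have f'origin x : eucl_norm x = 0 -> f' x = 0%E.
  by move=> x0; rewrite /f' patchE memNset//=; apply.
transitivity (\int[lebesgue_euclid R n]_x f' x)%E; last first.
  apply: ge0_ae_eq_integral => //.
  exists [set x | eucl_norm x = 0]; split.
  - exact: measurable_origin.
  - exact: lebesgue_euclid_origin.
  - move=> x /= nx; apply: contrapT => /eqP x0; apply: nx => _; exact: f'E.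
rewrite ge0_integral_polar; last 3 first.
- exact: emeasurable_funM.
- by move=> x; rewrite mule_ge0// lee_fin exprn_even_ge0// oddM.
- move=> x ->; rewrite invr0 mulr0 expr0n muln_eq0/= gtn_eqF// mule0 //.
rewrite [RHS]ge0_integral_polar//.
apply: eq_integral => x _; congr (_ * _)%E.
have [x0|x0] := eqVneq (eucl_norm x) 0.
  apply: eq_integral => u _.
  rewrite f'origin eucl_norm_dilation ?expR_ge0// x0 mulr0//.
  by rewrite invr0 mulr0 expr0n muln_eq0/= gtn_eqF// mule0.
rewrite integral_inversion_ray//; apply: eq_integral => u _.
rewrite f'E// eucl_norm_dilation ?expR_ge0// mulf_neq0//.
by rewrite gt_eqF// expR_gt0.
Qed.

Lemma ge0_integral_inversion2 (R : realType) (n : nat) (rho : R)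
    (F : euclid R n * euclid R n -> \bar R) :
  (0 < n)%N -> 0 < rho -> measurable_fun setT F -> (forall z, 0 <= F z)%E ->
  let J (x : euclid R n) := (rho / eucl_norm x) ^+ (2 * n) in
  (\int[lebesgue_euclid R n \x lebesgue_euclid R n]_z
     (F (inversion rho z.1, inversion rho z.2) * (J z.1 * J z.2)%:E) =
   \int[lebesgue_euclid R n \x lebesgue_euclid R n]_z F z)%E.
Proof.
move=> n0 rho0 mF F0 J.
have J0 x : 0 <= J x by rewrite /J exprn_even_ge0// oddM.
have mJ : measurable_fun setT J.
  apply: measurable_funX; apply: measurable_funM => //.
  exact: measurable_eucl_normV.
have minv := @measurable_inversion R n rho.
have mFinv : measurable_fun setT (fun z : euclid R n * euclid R n =>
    F (inversion rho z.1, inversion rho z.2) * (J z.1 * J z.2)%:E)%E.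
  apply: emeasurable_funM.
    apply: (measurableT_comp mF); apply: measurable_fun_pair.
      exact: (measurableT_comp minv).
    exact: (measurableT_comp minv).
  apply/measurable_EFinP; apply: measurable_funM; exact: (measurableT_comp mJ).
have Finv0 (z : euclid R n * euclid R n) :
    (0 <= F (inversion rho z.1, inversion rho z.2) * (J z.1 * J z.2)%:E)%E.
  by rewrite mule_ge0// lee_fin mulr_ge0.
rewrite fubini_tonelli1// fubini_tonelli1//.
have mFy y : measurable_fun setT (fun z => F (y, z)).
  exact: (measurableT_comp mF (measurable_pair1 y)).
have mFF : measurable_fun setT
    (fun y => \int[lebesgue_euclid R n]_z F (y, z))%E.
  exact: measurable_integral_pair.
rewrite -[RHS](ge0_integral_inversion n0 rho0 mFF); last first.
  by move=> y; exact: integral_ge0.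
apply: eq_integral => y _; rewrite /fubini_F/= -/(J y).
rewrite -(ge0_integral_inversion n0 rho0 (mFy _))// -ge0_integralZr//.
- by apply: eq_integral => z _; rewrite -/(J z) EFinM muleA muleAC.
- apply: emeasurable_funM.
    exact: (measurableT_comp (mFy _) minv).
  exact/measurable_EFinP.
- by move=> z _; rewrite mule_ge0// lee_fin; exact: J0.
- by rewrite lee_fin.
Qed.

(** * Conformal covariance of the equation *)

Lemma measurable_eucl_dist (R : realType) (n : nat) (d : measure_display)
    (T : measurableType d) (f g : T -> euclid R n) :
  measurable_fun setT f -> measurable_fun setT g ->
  measurable_fun setT (fun x => eucl_dist (f x) (g x)).
Proof.
move=> mf mg; apply: (measurableT_comp (@measurable_eucl_norm R n)).
apply/measurable_fun_tnthP => i.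
rewrite (_ : _ \o _ = fun x => (tnth (f x) i : R) - tnth (g x) i); last first.
  by apply/funext => x /=; rewrite tnth_mktuple.
by apply: measurable_funB => //; exact: (measurableT_comp (measurable_tnth i)).
Qed.

(** Expanding |u x - w y|^2 reduces the squared identity to rational functions
    of |x|, |y| and the scalar product of x and y. *)
Lemma eucl_dist_inversion (R : realType) (n : nat) (rho : R)
    (x y : euclid R n) :
  0 <= rho -> eucl_norm x != 0 -> eucl_norm y != 0 ->
  eucl_dist (inversion rho x) (inversion rho y) =
  (rho / eucl_norm x) * (rho / eucl_norm y) * eucl_dist x y.
Proof.
move=> rho0 x0 y0.
have expand u w : eucl_dist (dilation u x) (dilation w y) ^+ 2 =
    u ^+ 2 * eucl_norm x ^+ 2
    - 2 * u * w * \sum_(i < n) (tnth x i : R) * tnth y i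
    + w ^+ 2 * eucl_norm y ^+ 2.
  rewrite /eucl_dist !sqr_eucl_norm !mulr_sumr -sumrB -big_split/=.
  by apply: eq_bigr => i _; rewrite !tnth_mktuple; ring.
apply/eqP; rewrite -(@eqrXn2 _ 2)//; last 2 first.
- exact: eucl_norm_ge0.
- by rewrite !mulr_ge0 ?invr_ge0 ?eucl_norm_ge0.
rewrite exprMn.
have -> : eucl_dist x y = eucl_dist (dilation 1 x) (dilation 1 y).
  by congr eucl_norm; apply: eq_from_tnth => i; rewrite !tnth_mktuple !mul1r.
by rewrite !inversionE !expand; apply/eqP; field; rewrite x0 y0.
Qed.

(** The factors of a = rho/|y| produced by the Jacobian, by |y^rho|^(-alpha) =
    (a^2 |y|)^(-alpha) and by the two distances from y^rho; their product is
    the one absorbed by V_rho(y)^s. *)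
Lemma powR_conformal_weight (R : realType) (n : nat) (alpha lambda a : R) :
  0 < a -> alpha + lambda != 0 ->
  a ^+ (2 * n) * (a `^ (- alpha) * a `^ (- alpha)) *
    ((a `^ lambda)^-1 * (a `^ lambda)^-1) =
  (a `^ (2 * (alpha + lambda))) `^
    ((n%:R - alpha - lambda) / (alpha + lambda)).
Proof.
move=> a0 al0; rewrite -!powRN -powR_mulrn ?ltW//.
rewrite -!powRrM -!powRD ?(gt_eqF a0) ?implybT//; congr (_ `^ _).
by rewrite natrM; field.
Qed.

(** The integrand of [equation_rhs] for a real-valued solution. *)
Definition integrand (R : realType) (n : nat) (alpha lambda s : R)
    (v : euclid R n -> R) (x : euclid R n) (yz : euclid R n * euclid R n) : R :=
  v yz.1 `^ s * eucl_norm yz.1 `^ (- alpha) *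
  (v yz.2 `^ s * eucl_norm yz.2 `^ (- alpha)) *
  (eucl_dist x yz.1 `^ lambda * eucl_dist x yz.2 `^ lambda *
   eucl_dist yz.1 yz.2 `^ lambda)^-1.

Lemma integrand_ge0 (R : realType) (n : nat) (alpha lambda s : R)
    (v : euclid R n -> R) (x : euclid R n) (yz : euclid R n * euclid R n) :
  0 <= integrand alpha lambda s v x yz.
Proof. by rewrite !mulr_ge0 ?invr_ge0 ?mulr_ge0 ?powR_ge0. Qed.

Lemma measurable_integrand (R : realType) (n : nat) (alpha lambda s : R)
    (v : euclid R n -> R) (x : euclid R n) :
  measurable_fun setT v ->
  measurable_fun setT (integrand alpha lambda s v x).
Proof.
move=> mv.
have mpow p (f : euclid R n * euclid R n -> R) : measurable_fun setT f ->
    measurable_fun setT (fun z => f z `^ p).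
  exact: (measurableT_comp (@measurable_powR R p)).
have mone (f : euclid R n * euclid R n -> euclid R n) : measurable_fun setT f ->
    measurable_fun setT (fun z => v (f z) `^ s * eucl_norm (f z) `^ (- alpha)).
  move=> mf; apply: measurable_funM; apply: mpow.
    exact: (measurableT_comp mv).
  exact: (measurableT_comp (@measurable_eucl_norm R n)).
rewrite (_ : integrand _ _ _ _ _ = fun z : euclid R n * euclid R n =>
  v z.1 `^ s * eucl_norm z.1 `^ (- alpha) *
  (v z.2 `^ s * eucl_norm z.2 `^ (- alpha)) *
  (eucl_dist x z.1 `^ (- lambda) * eucl_dist x z.2 `^ (- lambda) *
   eucl_dist z.1 z.2 `^ (- lambda))); last first.
  by apply/funext => z; rewrite /integrand !invfM !powRN.
apply: measurable_funM; first by apply: measurable_funM; exact: mone.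
by apply: measurable_funM; [apply: measurable_funM|]; apply: mpow;
  apply: measurable_eucl_dist.
Qed.

(** The Kelvin-type transform V_rho of a real-valued function, with the
    exponent [p] for 2(alpha + lambda). *)
Definition kelvin (R : realType) (n : nat) (p rho : R) (v : euclid R n -> R)
  (x : euclid R n) : R := (rho / eucl_norm x) `^ p * v (inversion rho x).

(** The identity holds even where y or z is the origin: the Jacobian and the
    transform of [v] both vanish there, by the conventions 1/0 = 0 and
    [powR0]. *)
Lemma integrand_inversion (R : realType) (n : nat) (alpha lambda rho : R)
    (v : euclid R n -> R) (x : euclid R n) (yz : euclid R n * euclid R n) :
  let s := (n%:R - alpha - lambda) / (alpha + lambda) in
  let J (x : euclid R n) := (rho / eucl_norm x) ^+ (2 * n) in
  (0 < n)%N -> 0 < rho -> 0 < alpha + lambda < n%:R ->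
  (forall x, 0 <= v x) -> eucl_norm x != 0 ->
  integrand alpha lambda s v (inversion rho x)
    (inversion rho yz.1, inversion rho yz.2) * (J yz.1 * J yz.2) =
  ((rho / eucl_norm x) `^ lambda)^-1 ^+ 2 *
  integrand alpha lambda s (kelvin (2 * (alpha + lambda)) rho v) x yz.
Proof.
move=> s J n0 rho0 /andP[al0 aln] v0 x0; case: yz => y z /=.
have s0 : s != 0 by rewrite /s mulf_neq0 ?invr_neq0//; lra.
have J_origin u : eucl_norm u = 0 -> J u = 0.
  by move=> u0; rewrite /J u0 invr0 mulr0 expr0n muln_eq0/= gtn_eqF.
have kelvin_origin u : eucl_norm u = 0 ->
    kelvin (2 * (alpha + lambda)) rho v u `^ s = 0.
  move=> u0; rewrite /kelvin u0 invr0 mulr0 powR0 ?mul0r ?powR0//.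
  by rewrite mulf_neq0//; lra.
have [y0|y0] := eqVneq (eucl_norm y) 0.
  by rewrite J_origin// /integrand/= kelvin_origin// !(mul0r, mulr0).
have [z0|z0] := eqVneq (eucl_norm z) 0.
  by rewrite (J_origin z)// /integrand/= (kelvin_origin z)// !(mul0r, mulr0).
have pos (u : euclid R n) : eucl_norm u != 0 -> 0 < rho / eucl_norm u.
  by move=> u0; rewrite divr_gt0// eucl_norm_gt0.
rewrite /integrand/= /J !eucl_dist_inversion ?(ltW rho0)// /kelvin.
have normE (u : euclid R n) : eucl_norm u != 0 ->
    eucl_norm (inversion rho u) = (rho / eucl_norm u) ^+ 2 * eucl_norm u.
  by move=> u0; rewrite eucl_norm_inversion; field.
rewrite !normE//.
have := pos _ x0; have := pos _ y0; have := pos _ z0.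
set a := rho / eucl_norm x; set b := rho / eucl_norm y.
set c := rho / eucl_norm z => c0 b0 a0.
have v0y := v0 (inversion rho y); have v0z := v0 (inversion rho z).
move: (v _) (v _) v0y v0z => vz vy vy0 vz0.
move: a b c a0 b0 c0 => a b c a0 b0 c0.
have d0 (u w : euclid R n) : 0 <= eucl_dist u w by exact: eucl_norm_ge0.
rewrite !powRM ?mulr_ge0 ?powR_ge0 ?eucl_norm_ge0 ?exprn_ge0 ?(ltW a0) ?(ltW b0) ?(ltW c0)//.
(* The distances may vanish, so the inverses are kept as they are and only
   the powers of a, b and c are matched. *)
rewrite -!powR_conformal_weight// ?gt_eqF//.
move: (a `^ lambda) (b `^ lambda) (c `^ lambda) (b `^ _) (c `^ _).
move: (b ^+ _) (c ^+ _) (vz `^ _) (vy `^ _) (eucl_norm y) (eucl_norm z).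
move: (eucl_dist x y) (eucl_dist x z) (eucl_dist y z); clear.
by move=> *; rewrite !invfM; ring.
Qed.

Lemma measurable_kelvin (R : realType) (n : nat) (p rho : R)
    (v : euclid R n -> R) :
  measurable_fun setT v -> measurable_fun setT (kelvin p rho v).
Proof.
move=> mv; apply: measurable_funM.
  apply: (measurableT_comp (@measurable_powR R p)).
  by apply: measurable_funM => //; exact: measurable_eucl_normV.
exact: (measurableT_comp mv (@measurable_inversion R n rho)).
Qed.

Lemma equation_rhsE (R : realType) (n : nat) (alpha lambda C : R)
    (v : euclid R n -> R) (x : euclid R n) :
  let s := (n%:R - alpha - lambda) / (alpha + lambda) in
  equation_rhs alpha lambda C (EFin \o v) x =
  ((C * eucl_norm x `^ (- alpha))%:E *
   \int[lebesgue_euclid R n \x lebesgue_euclid R n]_yz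
     (integrand alpha lambda s v x yz)%:E)%E.
Proof. by []. Qed.

(** With b = rho/|x|, the factor |x^rho|^(-alpha) contributes b^(-2 alpha) and
    the two distances from x^rho contribute b^(-2 lambda) to the right-hand
    side at x^rho; the exponent of the transform compensates exactly these. *)
Lemma equation_rhs_kelvin (R : realType) (n : nat) (alpha lambda C rho : R)
    (v : euclid R n -> R) (x : euclid R n) :
  (0 < n)%N -> 0 < rho -> 0 < alpha + lambda < n%:R ->
  measurable_fun setT v -> (forall x, 0 <= v x) -> eucl_norm x != 0 ->
  equation_rhs alpha lambda C
    (EFin \o kelvin (2 * (alpha + lambda)) rho v) x =
  (((rho / eucl_norm x) `^ (2 * (alpha + lambda)))%:E *
   equation_rhs alpha lambda C (EFin \o v) (inversion rho x))%E.
Proof.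
move=> n0 rho0 al mv v0 x0; rewrite !equation_rhsE.
set s := (_ / (alpha + lambda)).
have mk := measurable_kelvin (2 * (alpha + lambda)) rho mv.
have mI w y : measurable_fun setT w ->
    measurable_fun setT (EFin \o integrand alpha lambda s (w : euclid R n -> R) y).
  by move=> mw; apply/measurable_EFinP; exact: measurable_integrand.
have I0 (w : euclid R n -> R) y z :
    (0 <= (EFin \o integrand alpha lambda s w y) z)%E.
  by rewrite lee_fin integrand_ge0.
rewrite -[X in (_ = _ * (_ * X))%E](ge0_integral_inversion2 n0 rho0 (mI _ _ mv))//.
pose b := rho / eucl_norm x.
have b0 : 0 < b by rewrite divr_gt0// eucl_norm_gt0.
under [X in (_ = _ * (_ * X))%E]eq_integral => z _.
  rewrite /= -EFinM integrand_inversion// EFinM. over.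
rewrite (ge0_integralZl_EFin _ measurableT (fun z _ => I0 _ _ z) (mI _ _ mk));
  last by rewrite exprn_ge0// invr_ge0 powR_ge0.
rewrite 2!muleA; congr (_ * _)%E.
rewrite -!EFinM -/b; congr EFin.
rewrite eucl_norm_inversion (_ : rho ^+ 2 / _ = b * b * eucl_norm x); last first.
  by rewrite /b; field.
move: b b0 => b b0.
rewrite !powRM ?mulr_ge0 ?eucl_norm_ge0 ?(ltW b0)//.
have -> : b `^ (2 * (alpha + lambda)) =
    b `^ alpha * b `^ alpha * (b `^ lambda * b `^ lambda).
  rewrite -!powRD ?(gt_eqF b0) ?implybT//; congr (_ `^ _); ring.
rewrite !powRN.
have : b `^ alpha != 0 by rewrite gt_eqF// powR_gt0.
have : b `^ lambda != 0 by rewrite gt_eqF// powR_gt0.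
move: (b `^ alpha) (b `^ lambda) (eucl_norm x `^ _)^-1; clear => A B D A0 B0.
by field; rewrite A0 B0.
Qed.

(** * Lebesgue measurable functions and null sets *)

(** The sets that coincide with a measurable set off a measurable null set form
    a sigma-algebra, and it contains the generators. *)
Lemma negligible_measurable_mod (d : measure_display) (T : measurableType d)
    (R : realType) (mu : {measure set T -> \bar R}) (A : set T) :
  (completed_algebra_gen mu).-sigma.-measurable A ->
  exists B N, [/\ measurable B, measurable N, mu N = 0%E &
    A `\` N = B `\` N].
Proof.
pose mod_null : set (set T) := fun A => exists B N,
  [/\ measurable B, measurable N, mu N = 0%E & A `\` N = B `\` N].
move=> mA; suff : mod_null A by [].
apply: smallest_sub mA; last first.
  move=> _ [B mB] [N [M [mM M0 NM]]] <-.
  exists B, M; split=> //; apply/seteqP; split=> x [BN Mx]; split=> //.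
    by case: BN => // /NM.
  by left.
split.
- by exists set0, set0; split.
- move=> B [C [N [mC mN N0 BC]]]; exists (~` C), N.
  split=> //; first exact: measurableC.
  rewrite setTD; apply/seteqP; split=> x [Bx Nx]; split=> // Cx; apply: Bx.
    by have [] : (B `\` N) x by rewrite BC.
  by have [] : (C `\` N) x by rewrite -BC.
- move=> F FP.
  have /choice[B /choice[N BN]] := FP.
  exists (\bigcup_k B k), (\bigcup_k N k); split.
  + by apply: bigcupT_measurable => k; case: (BN k).
  + by apply: bigcupT_measurable => k; case: (BN k).
  + apply/negligibleP; first by apply: bigcupT_measurable => k; case: (BN k).
    apply: negligible_bigcup => k; exists (N k).
    by case: (BN k) => *; split.
  + apply/seteqP; split=> x [[k _ kx] Nx]; split=> //; exists k => //.
      have [] // : (B k `\` N k) x.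
      by case: (BN k) => _ _ _ <-; split=> // Nkx; apply: Nx; exists k.
    have [] // : (F k `\` N k) x.
    by case: (BN k) => _ _ _ ->; split=> // Nkx; apply: Nx; exists k.
Qed.

(** Each set {V > q} with q rational is measurable off a null set; off the
    union M of these countably many null sets, V is measurable, because
    {V > r} is the union of the {V > q} over the rationals q > r. *)
Lemma measurable_off_null (d : measure_display) (T : measurableType d)
    (R : realType) (mu : {measure set T -> \bar R}) (V : T -> \bar R) :
  measurable_fun [set: g_sigma_algebraType (completed_algebra_gen mu)] V ->
  exists M, [/\ measurable M, mu M = 0%E & measurable_fun (~` M) V].
Proof.
move=> mV.
have /choice[B /choice[N BN]] (q : rat) : exists B N,
    [/\ measurable B, measurable N, mu N = 0%E &
     V @^-1` `](ratr q)%:E, +oo[ `\` N = B `\` N].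
  apply: negligible_measurable_mod; rewrite -[X in measurable X]setTI.
  by apply: mV => //; exact: emeasurable_itv.
have mM : measurable (\bigcup_(q : rat) N q).
  by apply: bigcupT_measurable_rat => q; case: (BN q).
exists (\bigcup_(q : rat) N q); split => //.
  apply/negligibleP => //.
  have /card_esym/ppcard_eqP[e] := card_rat.
  rewrite (reindex_bigcup e setT)//.
  by apply: negligible_bigcup => k; exists (N (e k)); case: (BN (e k)) => *; split.
apply: (measurability _ (ErealGenOInfty.measurableE R)) => // _ [_ [r ->] <-].
rewrite (_ : _ `&` _ = \bigcup_(q in [set q : rat | r < ratr q])
    (B q `\` \bigcup_q N q)).
  rewrite bigcup_mkcond; apply: bigcupT_measurable_rat => q.
  by case: ifPn => // _; apply: measurableD => //; case: (BN q).
apply/seteqP; split=> x.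
- move=> [Mx /=]; rewrite in_itv/= andbT => rV.
  have [q /andP[rq qV]] : exists q : rat, (r < ratr q) && ((ratr q)%:E < V x)%E.
    have [y ry yV] : exists2 y : R, r < y & (y%:E <= V x)%E.
      case: (V x) rV => [y| |//]; first by rewrite lte_fin; exists y.
      by move=> _; exists (r + 1); [rewrite ltrDl|rewrite leey].
    have [q] := rat_in_itvoo ry; rewrite inE => /itvP qry.
    by exists q; rewrite qry (lt_le_trans _ yV)// lte_fin qry.
  exists q => //; split=> //.
  have [] // : (B q `\` N q) x; case: (BN q) => _ _ _ <-; split.
    by rewrite /= in_itv/= qV.
  by move=> Nx; apply: Mx; exists q.
- move=> [q /= rq [Bx Mx]]; split=> //=; rewrite in_itv/= andbT.
  have [] : (V @^-1` `](ratr q)%:E, +oo[ `\` N q) x.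
    case: (BN q) => _ _ _ ->; split=> // Nx; apply: Mx; exists q => //.
  by rewrite /= in_itv/= andbT => qV _; apply: lt_trans qV; rewrite lte_fin.
Qed.

Lemma lebesgue_measurable_off_null (R : realType) (n : nat)
    (W V : euclid R n -> \bar R) (N : set (euclid R n)) :
  measurable_fun setT W -> measurable N -> lebesgue_euclid R n N = 0%E ->
  (forall x, ~ N x -> V x = W x) -> lebesgue_measurable_fun V.
Proof.
move=> mW mN N0 VW _ Y mY; rewrite setTI; apply: sub_sigma_algebra.
exists (W @^-1` Y `\` N).
  by apply: measurableD => //; rewrite -[X in measurable X]setTI; exact: mW.
exists (V @^-1` Y `&` N); first by exists N; split=> // x [].
apply/seteqP; split=> x /=.
  by case=> [[WY Nx]|[]//]; rewrite VW.
by move=> VY; have [Nx|Nx] := pselect (N x); [right|left]; rewrite -?VW.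
Qed.

(** The integral of a nonnegative function is a supremum over the simple
    functions below it, whether the function is measurable or not. *)
Lemma ge0_le_integral_nonmeasurable (d : measure_display)
    (T : measurableType d) (R : realType) (mu : {measure set T -> \bar R})
    (f g : T -> \bar R) :
  (forall x, 0 <= f x)%E -> (forall x, f x <= g x)%E ->
  (\int[mu]_x f x <= \int[mu]_x g x)%E.
Proof.
move=> f0 fg; rewrite !ge0_integralTE//; last first.
  by move=> x; exact: le_trans (fg x).
apply: le_ereal_sup => _ [h hf <-]; exists h => // x.
exact: le_trans (fg x).
Qed.

(** As [f] may fail to be measurable on [N], it is squeezed between the
    measurable functions that equal [g] off [N] and are 0, respectively +oo,
    on [N]. *)
Lemma ge0_integral_off_null (d : measure_display)
    (T : measurableType d) (R : realType) (mu : {measure set T -> \bar R})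
    (f g : T -> \bar R) (N : set T) :
  (forall x, 0 <= f x)%E -> (forall x, 0 <= g x)%E -> measurable_fun setT g ->
  measurable N -> mu N = 0%E -> (forall x, ~ N x -> f x = g x) ->
  (\int[mu]_x f x = \int[mu]_x g x)%E.
Proof.
move=> f0 g0 mg mN N0 fg.
have mNC := measurableC mN.
pose lo := g \_ (~` N).
pose hi x := (lo x + (cst +oo \_ N) x)%E.
have mlo : measurable_fun setT lo.
  by apply/(measurable_restrictT g mNC); exact: (measurable_funTS mg).
have lo0 x : (0 <= lo x)%E by exact: erestrict_ge0.
have mhi : measurable_fun setT hi.
  by apply: emeasurable_funD => //; apply/(measurable_restrictT _ mN).
have hi0 x : (0 <= hi x)%E by rewrite adde_ge0//; apply: erestrict_ge0 => t _; exact: leey.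
have loE x : ~ N x -> lo x = g x by move=> Nx; rewrite /lo patchE mem_set.
have loN x : N x -> lo x = 0%E.
  by move=> Nx; rewrite /lo patchE memNset//; apply.
have hiE x : ~ N x -> hi x = g x.
  by move=> Nx; rewrite /hi loE// patchE memNset// adde0.
have hiN x : N x -> hi x = +oo%E.
  by move=> Nx; rewrite /hi loN// patchE mem_set// add0e.
have eqg (h : T -> \bar R) : measurable_fun setT h -> (forall x, 0 <= h x)%E ->
    (forall x, ~ N x -> h x = g x) -> (\int[mu]_x h x = \int[mu]_x g x)%E.
  move=> mh h0 hg; apply: ge0_ae_eq_integral => //.
  exists N; split=> // x /= nx; apply: contrapT => Nx; apply: nx => _.
  exact: hg.
apply/eqP; rewrite eq_le; apply/andP; split.
  rewrite -(eqg hi mhi hi0 hiE); apply: ge0_le_integral_nonmeasurable => // x.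
  by have [Nx|Nx] := pselect (N x); [rewrite hiN// leey|rewrite fg// hiE].
rewrite -(eqg lo mlo lo0 loE); apply: ge0_le_integral_nonmeasurable => // x.
by have [Nx|Nx] := pselect (N x); [rewrite loN|rewrite fg// loE].
Qed.

(** * The transform of a solution *)

Lemma inversionK (R : realType) (n : nat) (rho : R) (x : euclid R n) :
  0 < rho -> eucl_norm x != 0 -> inversion rho (inversion rho x) = x.
Proof.
move=> rho0 x0; rewrite [LHS]inversionE eucl_norm_inversion inversionE dilationM.
rewrite (_ : _ * _ = 1); last by field; rewrite x0 gt_eqF.
by apply: eq_from_tnth => i; rewrite tnth_mktuple mul1r.
Qed.

Lemma measurable_preimage_inversion (R : realType) (n : nat) (rho : R)
    (N : set (euclid R n)) :
  measurable N -> measurable (@inversion R n rho @^-1` N).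
Proof.
move=> mN; rewrite -[X in measurable X]setTI.
exact: measurable_inversion.
Qed.

(** By the change of variables, the measure of the preimage is the integral of
    the Jacobian over [N], up to the origin. *)
Lemma null_preimage_inversion (R : realType) (n : nat) (rho : R)
    (N : set (euclid R n)) :
  (0 < n)%N -> 0 < rho -> measurable N -> lebesgue_euclid R n N = 0%E ->
  lebesgue_euclid R n (@inversion R n rho @^-1` N) = 0%E.
Proof.
move=> n0 rho0 mN N0; set A := _ @^-1` N.
have mA : measurable A by exact: measurable_preimage_inversion.
pose f (x : euclid R n) : \bar R := (\1_A x)%:E.
have mf : measurable_fun setT f.
  by apply/measurable_EFinP; exact: measurable_indic.
have f0 x : (0 <= f x)%E by rewrite lee_fin indicE.
rewrite -(setIT A) -(integral_indic _ measurableT mA).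
rewrite -(ge0_integral_inversion n0 rho0 mf f0).
rewrite -[RHS](integral0 (lebesgue_euclid R n) setT).
apply: (@ge0_integral_off_null _ _ _ _ _ _ N) => //.
  move=> x; rewrite mule_ge0// lee_fin exprn_even_ge0// oddM//.
move=> x Nx; have [x0|x0] := eqVneq (eucl_norm x) 0.
  by rewrite x0 invr0 mulr0 expr0n muln_eq0/= gtn_eqF// mule0.
by rewrite /f indicE /A memNset ?mul0e//= inversionK.
Qed.

Lemma null_setXTT (d : measure_display) (T : measurableType d)
    (R : realType) (mu : {sigma_finite_measure set T -> \bar R}) (N : set T) :
  measurable N -> mu N = 0%E ->
  (mu \x mu)%E (N `*` setT `|` setT `*` N) = 0%E.
Proof.
move=> mN N0.
have NT : (mu \x mu)%E (N `*` setT) = 0%E.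
  transitivity (mu N * mu setT)%E; first exact: product_measure1E.
  by rewrite N0 mul0e.
have TN : (mu \x mu)%E (setT `*` N) = 0%E.
  transitivity (mu setT * mu N)%E; first exact: product_measure1E.
  by rewrite N0 mule0.
apply/negligibleP; first by apply: measurableU; exact: measurableX.
apply: negligibleU.
  by exists (N `*` setT); split=> //; exact: measurableX.
by exists (setT `*` N); split=> //; exact: measurableX.
Qed.

Lemma equation_rhs_off_null (R : realType) (n : nat) (alpha lambda C : R)
    (V : euclid R n -> \bar R) (v : euclid R n -> R) (N : set (euclid R n))
    (x : euclid R n) :
  measurable_fun setT v -> measurable N -> lebesgue_euclid R n N = 0%E ->
  (forall y, ~ N y -> V y = (v y)%:E) ->
  equation_rhs alpha lambda C V x = equation_rhs alpha lambda C (EFin \o v) x.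
Proof.
move=> mv mN N0 Vv; rewrite equation_rhsE /equation_rhs; congr (_ * _)%E.
apply: (@ge0_integral_off_null _ _ _ _ _ _ (N `*` setT `|` setT `*` N)).
- by move=> z; rewrite !mule_ge0 ?poweR_ge0// lee_fin ?powR_ge0// invr_ge0
    !mulr_ge0// powR_ge0.
- by move=> z; rewrite lee_fin integrand_ge0.
- by apply/measurable_EFinP; exact: measurable_integrand.
- by apply: measurableU; exact: measurableX.
- exact: null_setXTT.
- move=> [y z] /= Nyz; rewrite !Vv//; first by move=> Nz; apply: Nyz; right.
  by move=> Ny; apply: Nyz; left.
Qed.

(** [V] is replaced by 1 on the union of two null sets: the one off which [V]
    is Borel, and the one off which it is positive and finite. *)
Lemma positive_representative (R : realType) (n : nat)
    (V : euclid R n -> \bar R) :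
  lebesgue_measurable_fun V ->
  {ae lebesgue_euclid R n, forall x, (0 < V x < +oo)%E} ->
  exists (v : euclid R n -> R) (N : set (euclid R n)),
    [/\ measurable_fun setT v, forall x, 0 < v x, measurable N,
    lebesgue_euclid R n N = 0%E & forall x, ~ N x -> V x = (v x)%:E].
Proof.
move=> /measurable_off_null[M [mM M0 mV]] [B [mB B0 VB]].
have mMB : measurable (M `|` B) by exact: measurableU.
have VE x : ~ (M `|` B) x -> (0 < V x < +oo)%E.
  by move=> nx; apply: contrapT => Vx; apply: nx; right; exact: VB.
exists (fun x => fine ((V \_ (~` (M `|` B))) x) + \1_(M `|` B) x), (M `|` B).
split=> //.
- apply: measurable_funD; last exact: measurable_indic.
  apply: (measurableT_comp (@fine_measurable R setT measurableT)).
  apply/(measurable_restrictT V (measurableC mMB)).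
  apply: (measurable_funS (measurableC mM) _ mV).
  by apply: subsetC; exact: subsetUl.
- move=> x; rewrite patchE indicE in_setC.
  have [_|] /= := boolP (x \in M `|` B); first by rewrite add0r.
  by move=> /negP; rewrite in_setE addr0 => /VE; exact: fine_gt0.
- by apply/negligibleP => //; apply: negligibleU; [exists M|exists B]; split.
- move=> x nx; rewrite patchE indicE in_setC memNset//= addr0 fineK//.
  by have /andP[V0 Voo] := VE _ nx; rewrite ge0_fin_numE// ltW.
Qed.

Theorem proposition1p4 (R : realType) (n : nat) (alpha lambda C : R)
    (V : euclid R n -> \bar R) :
  (1 <= n)%N -> 0 <= alpha < n%:R -> 0 < lambda < n%:R ->
  alpha + lambda < n%:R -> 0 < C ->
  positive_solution alpha lambda C V ->
  forall (rho : R) (Vrho : euclid R n -> \bar R), 0 < rho ->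
    (forall x : euclid R n, x <> [tuple 0 | i < n] ->
      Vrho x = (((rho / eucl_norm x) `^ (2 * (alpha + lambda)))%:E *
                V (inversion rho x))%E) ->
    positive_solution alpha lambda C Vrho.
Proof.
move=> n0 /andP[alpha0 _] /andP[lambda0 _] aln C0 [mV posV [E [mE E0 solV]]].
move=> rho Vrho rho0 VrhoE.
have al : 0 < alpha + lambda < n%:R by rewrite aln andbT ltr_wpDl.
have [v [N [mv v0 mN N0 Vv]]] := positive_representative mV posV.
pose vrho := kelvin (2 * (alpha + lambda)) rho v.
have mvrho : measurable_fun setT vrho by exact: measurable_kelvin.
(* Off this null set, the inverse point is one where [V] is given by [v] and
   satisfies its equation. *)
pose Nrho := [set x : euclid R n | eucl_norm x = 0] `|`
  @inversion R n rho @^-1` (N `|` E).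
have mNE : measurable (N `|` E) by exact: measurableU.
have mNrho : measurable Nrho.
  apply: measurableU; first exact: measurable_origin.
  exact: measurable_preimage_inversion.
have Nrho0 : lebesgue_euclid R n Nrho = 0%E.
  apply/negligibleP => //; apply: negligibleU; apply/negligibleP => //.
  - exact: measurable_origin.
  - exact: lebesgue_euclid_origin.
  - exact: measurable_preimage_inversion.
  - apply: null_preimage_inversion => //; apply/negligibleP => //.
    by apply: negligibleU; [exists N|exists E]; split.
have Nrho_origin x : ~ Nrho x -> eucl_norm x != 0.
  by move=> nx; apply/eqP => x0; apply: nx; left.
have NrhoN x : ~ Nrho x -> ~ N (inversion rho x).
  by move=> nx Nx; apply: nx; right; left.
have Vrhov x : ~ Nrho x -> Vrho x = (vrho x)%:E.
  move=> nx; rewrite VrhoE; first by rewrite Vv//; exact: NrhoN.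
  by move=> x0; have := Nrho_origin _ nx; rewrite x0 eucl_norm0 eqxx.
split.
- apply: (lebesgue_measurable_off_null _ mNrho Nrho0 Vrhov).
  exact/measurable_EFinP.
- exists Nrho; split=> // x; apply: contra_notP => nx /=.
  rewrite Vrhov// ltry lte_fin andbT mulr_gt0// powR_gt0// divr_gt0//.
  by rewrite eucl_norm_gt0 Nrho_origin.
- exists Nrho; split=> // x; apply: contra_notP => nx /=.
  rewrite (equation_rhs_off_null _ _ _ _ mvrho mNrho Nrho0 Vrhov).
  have x0 := Nrho_origin _ nx.
  rewrite /vrho equation_rhs_kelvin//; last by move=> y; exact: ltW.
  rewrite -(equation_rhs_off_null _ _ _ _ mv mN N0 Vv).
  rewrite (_ : equation_rhs _ _ _ V _ = V (inversion rho x)).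
    by rewrite Vrhov// Vv//; exact: NrhoN.
  apply: contrapT => neq; apply: nx; right; right.
  by apply: solV => /esym.
Qed.
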